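(* Let $\mathcal A=\{0,1,\dots,d-1\}$, let $\varphi:\mathcal A^*\to\mathcal A^*$ be a morphism with adjacency matrix $\Phi$, and let $u$ be an infinite word over $\mathcal A$ having the WELLDOC property. If $\det\Phi=\pm1$, then the infinite word $\varphi(u)$ has the WELLDOC property.
   Context: $\mathcal A^*$ is the set of finite words over $\mathcal A$. A morphism $\varphi:\mathcal A^*\to\mathcal A^*$ satisfies $\varphi(\varepsilon)=\varepsilon$ and $\varphi(wv)=\varphi(w)\varphi(v)$; for an infinite word $u=u_0u_1\cdots$ one sets $\varphi(u)=\varphi(u_0)\varphi(u_1)\cdots$. $|v|_a$ is the number of occurrences of the letter $a$ in the finite word $v$. The adjacency matrix $\Phi$ of $\varphi$ is the $d\times d$ matrix with $\Phi_{i,j}=|\varphi(j-1)|_{i-1}$ for $1\le i,j\le d$. An infinite word is aperiodic if it is not of the form $vw^\omega$ with $v,w$ finite words ($w$ nonempty; $w^\omega$ is the infinite repetition of $w$). A finite word $w$ is a factor of $u$ if $w=u_i\cdots u_{i+|w|-1}$ for some $i$; each such $i$ is an occurrence of $w$ in $u$. $\mathrm{Pref}_n u=u_0\cdots u_{n-1}$. WELLDOC property: an aperiodic infinite word $u$ over $\{0,1,\dots,d-1\}$ has the WELLDOC property if for every positive integer $m$ and every factor $w$ of $u$, denoting by $i_0,i_1,\dots$ the occurrences of $w$ in $u$, one has $$\{(|\mathrm{Pref}_{i_j}u|_0,\dots,|\mathrm{Pref}_{i_j}u|_{d-1})\bmod m : j\in\mathbb N\}=\mathbb Z_m^d.$$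 *)

(* Defs.v *)
From HB Require Import structures.
From mathcomp Require Import all_boot all_order all_algebra.

Set Implicit Arguments.
Unset Strict Implicit.
Unset Printing Implicit Defensive.

(* Over the alphabet 'I_d, finite words are [seq 'I_d] and infinite words are *)
(* functions [nat -> 'I_d], compared extensionally.                           *)

Definition pref (T : Type) (u : nat -> T) (n : nat) : seq T := mkseq u n.

Definition inf_cat (T : Type) (v : seq T) (x : nat -> T) : nat -> T :=
  fun n => if n < size v then nth (x 0) v n else x (n - size v).

(* The default letter [x0] is irrelevant for nonempty [w]. *)
Definition omega (T : Type) (x0 : T) (w : seq T) : nat -> T :=
  fun n => nth x0 w (n %% size w).

Definition aperiodic (T : Type) (u : nat -> T) : Prop :=
  forall v w : seq T, 0 < size w -> ~ (u =1 inf_cat v (omega (u 0) w)).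

Definition occurrence (T : Type) (u : nat -> T) (w : seq T) (i : nat) : Prop :=
  w = mkseq (fun k => u (i + k)) (size w).

Definition factor (T : Type) (u : nat -> T) (w : seq T) : Prop :=
  exists i, occurrence u w i.

(* The inclusion of the set of residue vectors in Z_m^d is automatic, so that *)
(* equality with Z_m^d means that every vector of residues is reached.        *)
Definition welldoc (d : nat) (u : nat -> 'I_d) : Prop :=
  aperiodic u /\
  forall m : nat, 0 < m ->
  forall w : seq 'I_d, factor u w ->
  forall x : {ffun 'I_d -> 'I_m},
  exists i : nat, occurrence u w i /\
    forall a : 'I_d, count_mem a (pref u i) %% m = x a.

Definition word_morphism (T : Type) (phi : seq T -> seq T) : Prop :=
  phi [::] = [::] /\ forall w v, phi (w ++ v) = phi w ++ phi v.

(* [is_inf_concat x v]: the concatenation x_0 x_1 x_2 ... of finite words is  *)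
(* infinite and equal to [v].                                                 *)
Definition is_inf_concat (T : Type) (x : nat -> seq T) (v : nat -> T) : Prop :=
  let p n := flatten (mkseq x n) in
  (forall n, p n = pref v (size (p n))) /\ (forall k, exists n, k <= size (p n)).

(* phi(u) = phi(u_0) phi(u_1) ... is a relation, because the concatenation    *)
(* need not be infinite when phi erases letters; [v] is unique if it exists.  *)
Definition is_image (T : Type) (phi : seq T -> seq T) (u v : nat -> T) : Prop :=
  is_inf_concat (fun n => phi [:: u n]) v.

Definition adjacency (d : nat) (phi : seq 'I_d -> seq 'I_d) : 'M[int]_d :=
  \matrix_(i, j) Posz (count_mem i (phi [:: j])).

(* Main.v *)
Require Import Defs.
From HB Require Import structures.
From mathcomp Require Import all_boot all_order all_algebra.

(** Write P(x) for the vector of letter counts of a finite word x, so that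
P(phi x) = Phi P(x) with Phi the adjacency matrix.

As det Phi is nonzero, no column of Phi vanishes: phi erases no letter, and the
image of u is an infinite word.

Let v be that image and let w occur in v at position i.  Some prefix W of u has
an image covering this occurrence.  Each occurrence j of W in u then yields an
occurrence |phi (pref u j)| + i of w in v, and the prefix of v that ends there
has count vector Phi P(pref u j) + P(pref v i) ([occurrence_image]).  Because
Phi is invertible over the integers and P(pref u j) runs through all residue
vectors modulo m, so does this sum ([unimodular_residues]).

Aperiodicity of v follows from the case of the empty word w.  If v had period p
from position N on, then modulo m the count vectors of its prefixes would all
be attained at lengths below N + p m, so there would be at most N + p m of them
([periodic_residues_bound]), fewer than the required m ^ d when d is at least 2
and m = N + p + 1.  An alphabet with at most one letter carries no aperiodic
word. *)

Set Implicit Arguments.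
Unset Strict Implicit.
Unset Printing Implicit Defensive.

Import GRing.Theory.

(** * Prefixes and occurrences *)

Lemma size_pref (T : Type) (u : nat -> T) n : size (pref u n) = n.
Proof. exact: size_mkseq. Qed.

Lemma nth_pref (T : Type) (x0 : T) (u : nat -> T) n k :
  k < n -> nth x0 (pref u n) k = u k.
Proof. exact: nth_mkseq. Qed.

Lemma prefD (T : Type) (u : nat -> T) i n :
  pref u (i + n) = pref u i ++ mkseq (fun k => u (i + k)) n.
Proof.
rewrite /pref /mkseq iotaD map_cat add0n; congr (_ ++ _).
by rewrite -{1}[i]addn0 iotaDl -map_comp.
Qed.

Lemma prefS (T : Type) (u : nat -> T) n : pref u n.+1 = rcons (pref u n) (u n).
Proof. by rewrite /pref mkseqS. Qed.

Lemma occurrence_pref (T : Type) (u : nat -> T) n j :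
  occurrence u (pref u n) j -> pref u (j + n) = pref u j ++ pref u n.
Proof. by rewrite prefD /occurrence size_pref => <-. Qed.

Lemma factor_pref (T : Type) (u : nat -> T) n : factor u (pref u n).
Proof. by exists 0; rewrite /occurrence size_pref; apply: eq_mkseq. Qed.

Lemma occurrenceP (T : Type) (u : nat -> T) w i j :
  occurrence u w i -> (forall k, k < size w -> u (j + k) = u (i + k)) ->
  occurrence u w j.
Proof.
rewrite /occurrence => -> uij; rewrite size_mkseq in uij *.
apply: (@eq_from_nth _ (u 0)); rewrite !size_mkseq // => k lt_k.
by rewrite !nth_mkseq // uij.
Qed.

(** * Images of words under a morphism *)

Lemma morphism_flatten (T : Type) (phi : seq T -> seq T) w :
  word_morphism phi -> phi w = flatten [seq phi [:: a] | a <- w].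
Proof. by case=> phi0 phiD; elim: w => //= a w <-; rewrite -phiD. Qed.

Lemma flatten_images (T : Type) (phi : seq T -> seq T) (u : nat -> T) n :
  word_morphism phi ->
  flatten (mkseq (fun k => phi [:: u k]) n) = phi (pref u n).
Proof.
by move=> phiM; rewrite (morphism_flatten _ phiM) /pref /mkseq -map_comp.
Qed.

Lemma image_pref (T : Type) (phi : seq T -> seq T) (u v : nat -> T) :
  word_morphism phi -> is_image phi u v ->
  (forall n, phi (pref u n) = pref v (size (phi (pref u n)))) /\
  (forall k, exists n, k <= size (phi (pref u n))).
Proof.
move=> phiM [vP vinf]; split=> [n|k].
  by rewrite -flatten_images //; apply: vP.
by have [n] := vinf k; exists n; rewrite -flatten_images.
Qed.

Lemma count_morphism d (phi : seq 'I_d -> seq 'I_d) a w :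
  word_morphism phi ->
  count_mem a (phi w) = \sum_j count_mem a (phi [:: j]) * count_mem j w.
Proof.
case=> phi0 phiD; elim: w => [|b w IHw].
  by rewrite phi0 big1 // => j _; rewrite muln0.
rewrite -cat1s phiD count_cat IHw.
under [RHS]eq_bigr do rewrite count_cat mulnDr.
rewrite big_split /=; congr (_ + _).
rewrite (bigD1 b) //= eqxx muln1 big1 ?addn0 // => j /negPf bj.
by rewrite eq_sym bj muln0.
Qed.

Lemma nonerasing_size (T : Type) (phi : seq T -> seq T) w :
  word_morphism phi -> (forall a, 0 < size (phi [:: a])) ->
  size w <= size (phi w).
Proof.
move=> [phi0 phiD] ne; elim: w => [|a w IHw]; first by rewrite phi0.
by rewrite -cat1s phiD !size_cat leq_add.
Qed.

Lemma nonerasing_image (T : Type) (phi : seq T -> seq T) (u : nat -> T) :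
  word_morphism phi -> (forall a, 0 < size (phi [:: a])) ->
  exists v, is_image phi u v.
Proof.
move=> phiM ne; pose p n := phi (pref u n).
have le_p n : n <= size (p n).
  by rewrite -{1}(size_pref u n) nonerasing_size.
have pD k n x0 l : l < size (p k) -> nth x0 (p (k + n)) l = nth x0 (p k) l.
  by move=> lt_l; rewrite /p prefD phiM.2 nth_cat lt_l.
(* The words p n are nested and p k.+1 is long enough to have a
   letter at index k. *)
exists (fun k => nth (u 0) (p k.+1) k); split=> [n|k]; last first.
  by exists k; rewrite flatten_images.
rewrite flatten_images // -/(p n).
apply: (@eq_from_nth _ (u 0)); rewrite ?size_pref // => k lt_k.
rewrite nth_pref //; case: (leqP n k.+1) => [le_nk|/ltnW le_kn].
  by rewrite -(subnKC le_nk) pD.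
by rewrite -(subnKC le_kn) pD.
Qed.

(** An occurrence of a factor of the image propagates along the occurrences of
any prefix of the original word whose image covers it. *)
Lemma occurrence_image (T : Type) (phi : seq T -> seq T) (u v : nat -> T)
    w i n j :
  word_morphism phi -> is_image phi u v ->
  occurrence v w i -> i + size w <= size (phi (pref u n)) ->
  occurrence u (pref u n) j ->
  let s := size (phi (pref u j)) in
  occurrence v w (s + i) /\ pref v (s + i) = phi (pref u j) ++ pref v i.
Proof.
move=> phiM uv w_i le_w occ_j s; have [vP _] := image_pref phiM uv.
(* The image of [pref u n] starts v and recurs in v at position s. *)
have vs k : k < size (phi (pref u n)) -> v (s + k) = v k.
  move=> lt_k; have := vP (j + n).
  rewrite occurrence_pref // phiM.2 size_cat => /(congr1 (nth (v 0) ^~ (s + k))).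
  rewrite nth_pref ?ltn_add2l // nth_cat ltnNge leq_addr /= addKn.
  by rewrite vP nth_pref.
split.
  apply: occurrenceP w_i _ => k lt_k; rewrite -addnA vs //.
  by apply: leq_trans le_w; rewrite ltn_add2l.
rewrite prefD -vP; congr (_ ++ _); apply: (@eq_from_nth _ (v 0)).
  by rewrite size_mkseq size_pref.
rewrite size_mkseq => k lt_k; rewrite nth_mkseq // nth_pref // vs //.
by apply: leq_trans lt_k (leq_trans _ le_w); apply: leq_addr.
Qed.

(** * Unimodular adjacency matrices *)

Lemma adjacency_nonerasing d (phi : seq 'I_d -> seq 'I_d) a :
  (\det (adjacency phi) != 0)%R -> 0 < size (phi [:: a]).
Proof.
rewrite lt0n; apply: contraNneq => /size0nil phi_a.
rewrite (expand_det_col _ a) big1 // => i _.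
by rewrite mxE phi_a mul0r.
Qed.

(** An affine map whose linear part is a unimodular matrix is onto modulo m. *)
Lemma unimodular_residues d m (A : 'M[int]_d) (q : 'I_d -> nat)
    (x : {ffun 'I_d -> 'I_m}) :
  0 < m -> A \in unitmx ->
  exists y : {ffun 'I_d -> 'I_m}, forall c : 'I_d -> nat,
    (forall j, c j %% m = y j) ->
    forall a, (\sum_j A a j * (c j)%:Z + (q a)%:Z = (x a : nat)%:Z %[mod m])%Z.
Proof.
move=> m_gt0 uA.
have m_neq0 : (m%:Z != 0)%R by rewrite -lt0n.
pose b : 'cV[int]_d := (\col_a ((x a : nat)%:Z - (q a)%:Z))%R.
pose z := (invmx A *m b)%R.
have lt_z j : `|(z j ord0 %% m)%Z|%N < m.
  by rewrite -ltz_nat gez0_abs ?modz_ge0 // ltz_pmod.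
(* The residues sought are those of the solution z of A z = x - q. *)
exists [ffun j => Ordinal (lt_z j)] => c cP a; apply/eqP.
have /matrixP/(_ a ord0) : (A *m z = b)%R by rewrite mulKVmx.
rewrite !mxE => bE.
rewrite eqz_mod_dvd -addrA -[((q a)%:Z - _)%R]opprB -bE -sumrB.
apply: rpred_sum => j _; rewrite -mulrBr dvdz_mull // -eqz_mod_dvd.
by apply/eqP; rewrite modz_nat cP ffunE /= gez0_abs ?modz_ge0 //.
Qed.

(** * Eventually periodic words *)

Lemma periodic_from (T : Type) (u : nat -> T) (v w : seq T) n :
  0 < size w -> u =1 inf_cat v (omega (u 0) w) -> size v <= n ->
  u (n + size w) = u n.
Proof.
move=> w_gt0 uE le_n; rewrite [LHS]uE [RHS]uE /inf_cat !ltnNge le_n.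
by rewrite (leq_trans le_n) ?leq_addr //= /omega -addnBAC // modnDr.
Qed.

(** Each period adds the same amount to the number of occurrences of a. *)
Lemma count_periodic (T : eqType) (u : nat -> T) N p k j a :
  (forall n, N <= n -> u (n + p) = u n) ->
  count_mem a (pref u (N + j + k * p)) + k * count_mem a (pref u N) =
  count_mem a (pref u (N + j)) + k * count_mem a (pref u (N + p)).
Proof.
move=> uP; pose C n := count_mem a (pref u n); rewrite -!/(C _).
have CS n : C n.+1 = C n + (u n == a).
  by rewrite /C prefS -cats1 count_cat /= addn0.
have C1 i : C (N + i + p) + C N = C (N + i) + C (N + p).
  elim: i => [|i IHi]; first by rewrite addn0 addnC.
  by rewrite addnS addSn !CS uP ?leq_addr // addnAC IHi addnAC.
elim: k => [|k IHk]; first by rewrite !mul0n !addn0.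
rewrite mulSnr addnA mulSn addnA -[N + j + k * p]addnA C1 addnA addnAC IHk.
by rewrite mulSn [in RHS]addnCA [RHS]addnC.
Qed.

(** A word with period p from position N on has, modulo m, at most N + p * m
count vectors of prefixes; hence the bound if all m ^ d residue vectors occur. *)
Lemma periodic_residues_bound d (u : nat -> 'I_d) N p m :
  0 < p -> 0 < m -> (forall n, N <= n -> u (n + p) = u n) ->
  (forall x : {ffun 'I_d -> 'I_m},
     exists i, forall a, count_mem a (pref u i) %% m = x a) ->
  m ^ d <= N + p * m.
Proof.
move=> p_gt0 m_gt0 uP onto.
pose f (i : 'I_(N + p * m)) : {ffun 'I_d -> 'I_m} :=
  [ffun a => Ordinal (ltn_pmod (count_mem a (pref u i)) m_gt0)].
have f_onto x : x \in codom f.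
  have [i iP] := onto x.
  (* Beyond N, the residues depend on the length modulo p * m only. *)
  have [i' lt_i' i'P] : exists2 i', i' < N + p * m & forall a,
      count_mem a (pref u i') = count_mem a (pref u i) %[mod m].
    case: (ltnP i N) => [lt_i|le_i].
      by exists i => //; apply: ltn_addr.
    pose r := (i - N) %% (p * m); exists (N + r) => [|a].
      by rewrite ltn_add2l ltn_pmod // muln_gt0 p_gt0.
    have := count_periodic ((i - N) %/ (p * m) * m) r a uP.
    have -> : N + r + (i - N) %/ (p * m) * m * p = i.
      by rewrite -mulnA [m * p]mulnC -addnA [r + _]addnC -divn_eq subnKC.
    move=> /(congr1 (modn ^~ m)).
    by rewrite ![_ * m * _]mulnAC ![_ + _ * m]addnC !modnMDl => ->.
  apply/codomP; exists (Ordinal lt_i'); apply/ffunP=> a.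
  by apply: val_inj; rewrite ffunE /= i'P iP.
have := subset_leq_card (introT subsetP (fun x _ => f_onto x) :
  [set: {ffun 'I_d -> 'I_m}] \subset codom f).
rewrite cardsT card_ffun !card_ord => /leq_trans; apply.
by apply: leq_trans (card_size _) _; rewrite size_codom card_ord.
Qed.

Lemma aperiodic_card d (u : nat -> 'I_d) : aperiodic u -> 1 < d.
Proof.
case: d u => [|[|d]] u // => [|u_ap]; first by case: (u 0).
case: (u_ap [::] [:: u 0] isT) => n.
by rewrite (ord1 (u n)) [RHS]ord1.
Qed.

Lemma residues_aperiodic d (u : nat -> 'I_d) :
  1 < d ->
  (forall m, 0 < m -> forall x : {ffun 'I_d -> 'I_m},
     exists i, forall a, count_mem a (pref u i) %% m = x a) ->
  aperiodic u.
Proof.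
move=> d_gt1 onto v w w_gt0 uE.
pose m := (size v + size w).+1.
have := periodic_residues_bound w_gt0 (ltn0Sn _ : 0 < m)
  (fun n => periodic_from w_gt0 uE) (onto m isT).
apply/negP; rewrite -ltnNge; apply: (@leq_trans (m ^ 2)); last first.
  by rewrite leq_pexp2l.
rewrite -mulnn {2}/m mulSn mulnDl addnA -addSn leq_add2r.
by apply: leq_trans (leq_addr _ _); rewrite ltnS leq_addr.
Qed.

(** * Preservation of the WELLDOC property *)

Theorem mainTheorem4 (d : nat) (phi : seq 'I_d -> seq 'I_d) (u : nat -> 'I_d)
    (phi_morph : word_morphism phi) (u_welldoc : welldoc u)
    (det_phi : (\det (adjacency phi) = 1 \/ \det (adjacency phi) = -1)%R) :
  (exists v : nat -> 'I_d, is_image phi u v) /\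
  (forall v : nat -> 'I_d, is_image phi u v -> welldoc v).
Proof.
have phi_unit : adjacency phi \in unitmx.
  by rewrite unitmxE; case: det_phi => ->.
split.
  apply: nonerasing_image => // a; apply: adjacency_nonerasing.
  by case: det_phi => ->.
move=> v uv; have [u_ap u_res] := u_welldoc.
have v_res m : 0 < m -> forall w, factor v w ->
    forall x : {ffun 'I_d -> 'I_m}, exists i, occurrence v w i /\
      forall a, count_mem a (pref v i) %% m = x a.
  move=> m_gt0 w [i w_i] x.
  have [n le_n] := (image_pref phi_morph uv).2 (i + size w).
  have [y yP] := unimodular_residues (fun a => count_mem a (pref v i)) x
    m_gt0 phi_unit.
  have [j [occ_j jP]] := u_res m m_gt0 _ (factor_pref u n) y.
  have [occ prefE] := occurrence_image phi_morph uv w_i le_n occ_j.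
  exists (size (phi (pref u j)) + i); split=> // a.
  apply/eqP; rewrite -(modn_small (ltn_ord (x a))) -eqz_nat -!modz_nat.
  rewrite -(yP _ jP a) prefE count_cat (count_morphism _ _ phi_morph) PoszD.
  rewrite (big_morph _ PoszD (erefl _)) /=.
  by under [X in _ == ((X + _) %% _)%Z]eq_bigr do rewrite mxE.
split=> //; apply: residues_aperiodic (aperiodic_card u_ap) _ => m m_gt0 x.
have [i [_ iP]] := v_res m m_gt0 _ (factor_pref v 0) x.
by exists i.
Qed.
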